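(* Let $\gamma=\gamma_1\cup\gamma_2\subset\mathbb{R}^2$ be the Jordan curve with $\gamma_1=\{((1+2\cos\theta)^2,(1+2\cos\theta)^3):0\le\theta<2\pi\}$ and $\gamma_2=\{(5+4\cos\alpha,\ 11+14\cos\alpha+2\cos^2\alpha):0\le\alpha\le2\pi\}$. Let $d\ge 2$ and let $g_d$ be the Chebyshev-induced morphism on $\mathbb{C}^2/D_3\simeq\mathbb{C}^2$. Then $\gamma$ is the boundary in $\mathbb{R}^2$ of the set $K(g_d|_{\mathbb{C}^2})$ (which is contained in the real slice $\mathbb{R}^2\subset\mathbb{C}^2$).
   Context: $K(g_d|_{\mathbb{C}^2})$ is the set of $w\in\mathbb{C}^2$ whose forward orbit $\{g_d^k(w):k=1,2,\dots\}$ (iterates) is bounded in $\mathbb{C}^2$. Definition of $g_d$: the Chebyshev endomorphism $P_{A_2}^d:\mathbb{C}^2\to\mathbb{C}^2$ is defined by $P_{A_2}^d(e_1(t),e_2(t))=(e_1(t^d),e_2(t^d))$ for $t=(t_1,t_2,t_3)\in(\mathbb{C}^* )^3$ with $t_1t_2t_3=1$, where $t^d=(t_1^d,t_2^d,t_3^d)$ and $e_j$ is the $j$-th elementary symmetric polynomial. With $M_2(x,y)=(x+iy,\,x-iy)$ put $f_d=M_2^{-1}\circ P_{A_2}^d\circ M_2$. The surjective map $\tilde F:\mathbb{C}^2\to\mathbb{C}^2$, $\tilde F(x,y)=(x^2+y^2,\,x^3-3xy^2)$, is the quotient map by the dihedral group $D_3\subset GL(2,\mathbb{R})$ of order 6 generated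 by the rotation by $2\pi/3$ and $(x,y)\mapsto(x,-y)$; $g_d:\mathbb{C}^2\to\mathbb{C}^2$ is the unique polynomial map with $g_d\circ\tilde F=\tilde F\circ f_d$. The sets $\gamma_1,\gamma_2$ are Jordan arcs with common end points $(1,-1)$ and $(9,27)$; they are the sets of points with bounded $g_d$-orbit on the invariant curves $V(p^3-q^2)$ and $V(p^2+18p-8q-27)$ respectively. *)

(* Defs.v *)
From HB Require Import structures.
From mathcomp Require Import all_boot all_order all_algebra.
From mathcomp Require Import all_classical all_reals all_analysis.
From mathcomp Require Import complex ring.

Set Implicit Arguments.
Unset Strict Implicit.
Unset Printing Implicit Defensive.

Import Order.TTheory GRing.Theory Num.Theory.
Import numFieldNormedType.Exports.

Local Open Scope classical_set_scope.
Local Open Scope ring_scope.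

Section ChebyshevA2.
Variable R : realType.
Local Notation C := R[i].

Definition esym1 (t1 t2 t3 : C) : C := t1 + t2 + t3.
Definition esym2 (t1 t2 t3 : C) : C := t1 * t2 + t1 * t3 + t2 * t3.

Definition is_chebyshev_A2 (d : nat) (P : C * C -> C * C) : Prop :=
  forall t1 t2 t3 : C, t1 != 0 -> t2 != 0 -> t3 != 0 -> t1 * t2 * t3 = 1 ->
    P (esym1 t1 t2 t3, esym2 t1 t2 t3) =
      (esym1 (t1 ^+ d) (t2 ^+ d) (t3 ^+ d),
       esym2 (t1 ^+ d) (t2 ^+ d) (t3 ^+ d)).

(* Definite description ([idfun] is only the default of the choice operator):
   every point of C^2 is of the form (e_1(t), e_2(t)), and its image does not
   depend on t, so exactly one map satisfies [is_chebyshev_A2 d]. *)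
Definition chebyshev_A2 (d : nat) : C * C -> C * C :=
  @xget (C * C -> C * C)%type idfun [set P | is_chebyshev_A2 d P].

Definition M2 (w : C * C) : C * C := (w.1 + 'i * w.2, w.1 - 'i * w.2).
Definition M2inv (z : C * C) : C * C :=
  ((z.1 + z.2) / 2%:R, (z.1 - z.2) / (2%:R * 'i)).

Lemma M2K : cancel M2 M2inv.
Proof.
have i0 : 'i != 0 :> C by exact: neq0Ci.
by case=> x y; rewrite /M2 /M2inv /=; congr (_, _); field.
Qed.

Lemma M2invK : cancel M2inv M2.
Proof.
have i0 : 'i != 0 :> C by exact: neq0Ci.
by case=> x y; rewrite /M2 /M2inv /=; congr (_, _); field.
Qed.

Definition f_A2 (d : nat) : C * C -> C * C := M2inv \o chebyshev_A2 d \o M2.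

Definition Ftilde (w : C * C) : C * C :=
  (w.1 ^+ 2 + w.2 ^+ 2, w.1 ^+ 3 - 3%:R * w.1 * w.2 ^+ 2).

Definition polynomial_map (g : C * C -> C * C) : Prop :=
  exists p q : {poly {poly C}},
    forall w, g w = (p.[w.1%:P].[w.2], q.[w.1%:P].[w.2]).

Definition is_g_A2 (d : nat) (g : C * C -> C * C) : Prop :=
  polynomial_map g /\ g \o Ftilde = Ftilde \o f_A2 d.

(* Definite description: [Ftilde] is the quotient map by D_3 and [f_A2 d] maps
   D_3-orbits into D_3-orbits, so exactly one map satisfies [is_g_A2 d]. *)
Definition g_A2 (d : nat) : C * C -> C * C :=
  @xget (C * C -> C * C)%type idfun [set g | is_g_A2 d g].

(* [C^o] is [C] seen as a normed module over itself; this gives C^2 the product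
   (sup) norm. *)
Definition K_of (g : C * C -> C * C) : set (C * C) :=
  [set w | bounded_set ([set iter k g w | k in [set k | (0 < k)%N]]
                          : set (C^o * C^o)%type)].

Definition real_embed (v : R * R) : C * C := (v.1%:C%C, v.2%:C%C).

Definition gamma1 : set (R * R) :=
  [set ((1 + 2%:R * cos theta) ^+ 2, (1 + 2%:R * cos theta) ^+ 3)
     | theta in [set theta | 0 <= theta < 2%:R * pi]].

Definition gamma2 : set (R * R) :=
  [set (5%:R + 4%:R * cos alpha,
        11%:R + 14%:R * cos alpha + 2%:R * cos alpha ^+ 2)
     | alpha in [set alpha | 0 <= alpha <= 2%:R * pi]].

Definition gamma : set (R * R) := gamma1 `|` gamma2.

Definition jordan_curve (A : set (R * R)) : Prop :=
  exists c : R -> R * R,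
    [/\ {within `[0, 1], continuous c},
        c 0 = c 1,
        {in `[0, 1[ &, injective c} &
        c @` `[0, 1] = A].

End ChebyshevA2.

Definition boundary (T : topologicalType) (A : set T) : set T :=
  closure A `\` interior A.

(* Main.v *)
(* In the coordinates z1 = x + i y, z2 = x - i y the quotient map is
   (z1, z2) |-> (z1 z2, (z1^3 + z2^3) / 2), and with (z1, z2) = (e1 t, e2 t) the map
   g_d is t |-> t^d.  If an orbit is bounded, so are the roots t_i^(d^k) of the
   cubics X^3 - z1 X^2 + z2 X - 1, which forces |t_i| = 1 as t1 t2 t3 = 1; hence
   K(g_d) consists of the points (|z|^2, Re z^3) with z = t1 + t2 + t3, |t_i| = 1.
   The cubic X^3 - z X^2 + z^* X - 1 has all its roots on the unit circle iff its
   discriminant p^2 + 18 p - 8 q - 27 is nonpositive, where p = |z|^2 and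
   q = Re z^3, and a real pair (p, q) is of this form iff q^2 <= p^3.  So K(g_d) is
   the closed region q^2 <= p^3, p^2 + 18 p - 27 <= 8 q, whose boundary is
   where one of the two inequalities is an equality. *)
Require Import Defs.
From HB Require Import structures.
From mathcomp Require Import all_boot all_order all_algebra.
From mathcomp Require Import all_classical all_reals all_analysis.
From mathcomp Require Import complex ring lra.

Import Order.TTheory GRing.Theory Num.Theory.
Import numFieldNormedType.Exports.

Local Open Scope classical_set_scope.
Local Open Scope ring_scope.

(** * Polynomial maps and the Chebyshev recursion *)

Section PolynomialFunctions.
Variable C : comNzRingType.

(** Evaluation in the same order as in [polynomial_map], so that witnesses carry over. *)
Definition polyfun2 (f : C -> C -> C) : Prop :=
  exists p : {poly {poly C}}, forall x y, f x y = p.[x%:P].[y].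

Lemma polyfun2_cst (c : C) : polyfun2 (fun _ _ => c).
Proof. by exists c%:P%:P => x y; rewrite !hornerE. Qed.

Lemma polyfun2_fst : polyfun2 (fun x _ => x).
Proof. by exists 'X => x y; rewrite !hornerE. Qed.

Lemma polyfun2_snd : polyfun2 (fun _ y => y).
Proof. by exists 'X%:P => x y; rewrite !hornerE. Qed.

Lemma polyfun2_add f g :
  polyfun2 f -> polyfun2 g -> polyfun2 (fun x y => f x y + g x y).
Proof. by move=> [p hp] [q hq]; exists (p + q) => x y; rewrite hp hq !hornerE. Qed.

Lemma polyfun2_mul f g :
  polyfun2 f -> polyfun2 g -> polyfun2 (fun x y => f x y * g x y).
Proof. by move=> [p hp] [q hq]; exists (p * q) => x y; rewrite hp hq !hornerE. Qed.

Lemma polyfun2_opp f : polyfun2 f -> polyfun2 (fun x y => - f x y).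
Proof. by move=> [p hp]; exists (- p) => x y; rewrite hp !hornerE. Qed.

Lemma polyfun2_exp f n : polyfun2 f -> polyfun2 (fun x y => f x y ^+ n).
Proof. by move=> [p hp]; exists (p ^+ n) => x y; rewrite hp !hornerE. Qed.

End PolynomialFunctions.

Ltac polyfun2 := repeat first
  [ assumption | apply: polyfun2_add | apply: polyfun2_opp
  | apply: polyfun2_exp | apply: polyfun2_mul
  | exact: polyfun2_fst | exact: polyfun2_snd | exact: polyfun2_cst ].

(** * Power sums in e1 and e2, and their invariance under D_3 *)

Section PowerSums.
Variable C : fieldType.

(** Newton's recursion for t1^n + t2^n + t3^n, with x = e1, y = e2 and e3 = 1. *)
Fixpoint cheb (n : nat) (x y : C) : C :=
  match n with
  | 0 => 3%:R
  | 1 => x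
  | 2 => x ^+ 2 - 2%:R * y
  | (((m.+1 as m1).+1) as m2).+1 => x * cheb m2 x y - y * cheb m1 x y + cheb m x y
  end.

Lemma chebSSS n x y :
  cheb n.+3 x y = x * cheb n.+2 x y - y * cheb n.+1 x y + cheb n x y.
Proof. by []. Qed.

Lemma cheb_power_sum n (t1 t2 t3 : C) : t1 * t2 * t3 = 1 ->
  cheb n (t1 + t2 + t3) (t1 * t2 + t1 * t3 + t2 * t3)
  = t1 ^+ n + t2 ^+ n + t3 ^+ n.
Proof.
move=> e3; set x := t1 + t2 + t3; set y := t1 * t2 + _ + _.
suff: [/\ cheb n x y = t1 ^+ n + t2 ^+ n + t3 ^+ n,
   cheb n.+1 x y = t1 ^+ n.+1 + t2 ^+ n.+1 + t3 ^+ n.+1 &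
   cheb n.+2 x y = t1 ^+ n.+2 + t2 ^+ n.+2 + t3 ^+ n.+2] by case.
elim: n => [|n [h0 h1 h2]].
  by split; rewrite /= /x /y; ring.
split=> //; rewrite chebSSS h0 h1 h2.
(* Inserting e3 = 1 before the n-th power sum gives Newton's homogeneous identity, valid for all
   t. *)
rewrite -[t1 ^+ n + _ + _]mul1r -e3 /x /y !exprS; ring.
Qed.

(** The products t_i t_j again have product 1. Their first elementary symmetric function is e2 and
    their second is e3 e1 = e1, so the arguments are exchanged. *)
Lemma cheb_inv_power_sum n (t1 t2 t3 : C) :
  t1 != 0 -> t2 != 0 -> t3 != 0 -> t1 * t2 * t3 = 1 ->
  cheb n (t1 * t2 + t1 * t3 + t2 * t3) (t1 + t2 + t3)
  = t1 ^+ n * t2 ^+ n + t1 ^+ n * t3 ^+ n + t2 ^+ n * t3 ^+ n.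
Proof.
move=> z1 z2 z3 e3.
rewrite -!exprMn -cheb_power_sum; last by rewrite -[RHS](mulr1 1) -{1}e3 -e3; ring.
congr (cheb _ _ _).
rewrite -[LHS]mul1r -e3; ring.
Qed.

Local Notation Inv A x y := (A (x * y) ((x ^+ 3 + y ^+ 3) / 2%:R)).

(* The polynomials of weight r mod 3, where x has weight 1 and y weight 2, form
   a free module of rank two over C[x y, (x^3 + y^3)/2]; a basis is 1, x^3 when
   r = 0, x, y^2 when r = 1 and x^2, y when r = 2. *)
Definition weight0 (f : C -> C -> C) : Prop :=
  exists A B, [/\ polyfun2 C A, polyfun2 C B &
    forall x y, f x y = Inv A x y + Inv B x y * x ^+ 3].
Definition weight1 (f : C -> C -> C) : Prop :=
  exists A B, [/\ polyfun2 C A, polyfun2 C B &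
    forall x y, f x y = Inv A x y * x + Inv B x y * y ^+ 2].
Definition weight2 (f : C -> C -> C) : Prop :=
  exists A B, [/\ polyfun2 C A, polyfun2 C B &
    forall x y, f x y = Inv A x y * x ^+ 2 + Inv B x y * y].

Hypothesis two_neq0 : 2%:R != 0 :> C.

Ltac weight := move=> [A0 [B0 [? ? e0]]] [A1 [B1 [? ? e1]]] [A2 [B2 [? ? e2]]].

(** The relations x y = p and x^3 + y^3 = 2 q bring every product back to the basis and so dictate
    the coefficients. *)
Lemma weight0_step f g h : weight2 f -> weight1 g -> weight0 h ->
  weight0 (fun x y => x * f x y - y * g x y + h x y).
Proof.
weight.
exists (fun p q => B0 p q * p - (A1 p q * p + B1 p q * (2%:R * q)) + A2 p q).
exists (fun p q => A0 p q + B1 p q + B2 p q).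
split; [polyfun2 | polyfun2 | move=> x y; rewrite e0 e1 e2; by field].
Qed.

Lemma weight1_step f g h : weight0 f -> weight2 g -> weight1 h ->
  weight1 (fun x y => x * f x y - y * g x y + h x y).
Proof.
weight.
exists (fun p q => A0 p q + B0 p q * (2%:R * q) - A1 p q * p + A2 p q).
exists (fun p q => - (B0 p q * p) - B1 p q + B2 p q).
split; [polyfun2 | polyfun2 | move=> x y; rewrite e0 e1 e2; by field].
Qed.

Lemma weight2_step f g h : weight1 f -> weight0 g -> weight2 h ->
  weight2 (fun x y => x * f x y - y * g x y + h x y).
Proof.
weight.
exists (fun p q => A0 p q - B1 p q * p + A2 p q).
exists (fun p q => B0 p q * p - A1 p q + B2 p q).
split; [polyfun2 | polyfun2 | move=> x y; rewrite e0 e1 e2; by field].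
Qed.

Lemma cheb_weight m :
  [/\ weight0 (cheb (3 * m)), weight1 (cheb (3 * m).+1)
    & weight2 (cheb (3 * m).+2)].
Proof.
elim: m => [|m [h0 h1 h2]].
  rewrite muln0; split.
  - exists (fun _ _ => 3%:R), (fun _ _ => 0).
    by split; [polyfun2 | polyfun2 | move=> x y /=; ring].
  - exists (fun _ _ => 1), (fun _ _ => 0).
    by split; [polyfun2 | polyfun2 | move=> x y /=; ring].
  - exists (fun _ _ => 1), (fun _ _ => - 2%:R).
    by split; [polyfun2 | polyfun2 | move=> x y /=; ring].
rewrite mulnS addSn addSn addSn add0n.
have h3 : weight0 (cheb (3 * m).+3) by exact: weight0_step.
have h4 : weight1 (cheb (3 * m).+4) by exact: weight1_step.
by split=> //; exact: weight2_step.
Qed.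

Definition D3_invariant (f : C -> C -> C) : Prop :=
  exists G, polyfun2 C G /\ forall x y, f x y = Inv G x y.

(** These are the quotient coordinates of (cheb n x y, cheb n y x). Exchanging x and y fixes p and
    q, so expanding in the basis leaves only symmetric expressions such as x^6 + y^6 = 4 q^2 - 2
    p^3. *)
Lemma cheb_D3_invariant n :
  D3_invariant (fun x y => cheb n x y * cheb n y x) /\
  D3_invariant (fun x y => (cheb n x y ^+ 3 + cheb n y x ^+ 3) / 2%:R).
Proof.
have [h0 h1 h2] := cheb_weight (n %/ 3).
have symp x y : y * x = x * y :> C by rewrite mulrC.
have symq x y : (y ^+ 3 + x ^+ 3) / 2%:R = (x ^+ 3 + y ^+ 3) / 2%:R :> C by rewrite addrC.
rewrite (divn_eq n 3) mulnC.
case: (n %% 3)%N (ltn_pmod n (isT : 0 < 3)%N) => [|[|[|//]]] _;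
  rewrite ?addn0 ?addn1 ?addn2.
- case: h0 => A [B [? ? e]]; split.
  + exists (fun p q => A p q ^+ 2 + A p q * B p q * (2%:R * q) + B p q ^+ 2 * p ^+ 3).
    split; [polyfun2 | move=> x y]; rewrite !e (symp x) (symq x); by field.
  + exists (fun p q => A p q ^+ 3 + 3%:R * A p q ^+ 2 * B p q * q
      + 3%:R * A p q * B p q ^+ 2 * (2%:R * q ^+ 2 - p ^+ 3)
      + B p q ^+ 3 * (4%:R * q ^+ 3 - 3%:R * p ^+ 3 * q)).
    split; [polyfun2 | move=> x y]; rewrite !e (symp x) (symq x); by field.
- case: h1 => A [B [? ? e]]; split.
  + exists (fun p q => A p q ^+ 2 * p + A p q * B p q * (2%:R * q) + B p q ^+ 2 * p ^+ 2).
    split; [polyfun2 | move=> x y]; rewrite !e (symp x) (symq x); by field.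
  + exists (fun p q => A p q ^+ 3 * q + 3%:R * A p q ^+ 2 * B p q * p ^+ 2
      + 3%:R * A p q * B p q ^+ 2 * (p * q)
      + B p q ^+ 3 * (2%:R * q ^+ 2 - p ^+ 3)).
    split; [polyfun2 | move=> x y]; rewrite !e (symp x) (symq x); by field.
- case: h2 => A [B [? ? e]]; split.
  + exists (fun p q => A p q ^+ 2 * p ^+ 2 + A p q * B p q * (2%:R * q) + B p q ^+ 2 * p).
    split; [polyfun2 | move=> x y]; rewrite !e (symp x) (symq x); by field.
  + exists (fun p q => A p q ^+ 3 * (2%:R * q ^+ 2 - p ^+ 3)
      + 3%:R * A p q ^+ 2 * B p q * (p * q)
      + 3%:R * A p q * B p q ^+ 2 * p ^+ 2
      + B p q ^+ 3 * q).
    split; [polyfun2 | move=> x y]; rewrite !e (symp x) (symq x); by field.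
Qed.

End PowerSums.

(** * Cubics with roots on the unit circle *)

Section CubicRoots.
Variable C : numClosedFieldType.
Implicit Types t x y a : C.

(** One root t of X^3 = 1 - y X + x X^2 exists by algebraic closedness; the other two have sum x - t
    and product 1 / t. *)
Lemma cubic_roots x y : exists t1 t2 t3,
  [/\ t1 * t2 * t3 = 1, t1 + t2 + t3 = x & t1 * t2 + t1 * t3 + t2 * t3 = y].
Proof.
have [t ht] := @solve_monicpoly C 3 (nth 0 [:: 1; - y; x]) isT.
rewrite !big_ord_recr big_ord0 /= add0r expr0 expr1 mulr1 in ht.
have t0 : t != 0.
  apply/eqP => t0; move/eqP: ht.
  by rewrite t0 !expr0n !mulr0 !addr0 eq_sym oner_eq0.
set s := x - t; set r := sqrtC (s ^+ 2 - 4%:R * t^-1).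
have hr : r ^+ 2 = s ^+ 2 - 4%:R * t^-1 by exact: sqrtCK.
have hm : (s + r) / 2%:R * ((s - r) / 2%:R) = t^-1.
  have -> : (s + r) / 2%:R * ((s - r) / 2%:R) = (s ^+ 2 - r ^+ 2) / 4%:R by field.
  by rewrite hr; field.
exists t, ((s + r) / 2%:R), ((s - r) / 2%:R); split.
- by rewrite -mulrA hm mulfV.
- by rewrite /s; field.
- rewrite hm.
  have -> : t * ((s + r) / 2%:R) + t * ((s - r) / 2%:R) + t^-1 = t * s + t^-1 by field.
  rewrite /s.
  have -> : t^-1 = (t ^+ 3 + y * t - x * t ^+ 2) / t by rewrite ht; field.
  by field.
Qed.

(** * The discriminant and the location of the roots *)

Definition vdm3 t1 t2 t3 : C := (t1 - t2) * (t1 - t3) * (t2 - t3).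

(** The square is the discriminant of X^3 - x X^2 + y X - 1; with e3 kept as a variable the identity
    holds for all t. *)
Lemma vdm3_sqr t1 t2 t3 : t1 * t2 * t3 = 1 ->
  let x := t1 + t2 + t3 in let y := t1 * t2 + t1 * t3 + t2 * t3 in
  vdm3 t1 t2 t3 ^+ 2
  = (x * y) ^+ 2 + 18%:R * (x * y) - 8%:R * ((x ^+ 3 + y ^+ 3) / 2%:R) - 27%:R.
Proof.
move=> e3 x y.
have -> : vdm3 t1 t2 t3 ^+ 2 = (x * y) ^+ 2 + 18%:R * (x * y) * (t1 * t2 * t3)
    - 4%:R * (x ^+ 3 * (t1 * t2 * t3) + y ^+ 3) - 27%:R * (t1 * t2 * t3) ^+ 2.
  by rewrite /x /y /vdm3; ring.
by rewrite e3; field.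
Qed.

Lemma conjC_unit t : `|t| = 1 -> t^* = t^-1.
Proof. by move=> t1; rewrite invC_norm t1 expr1n invr1 mul1r. Qed.

Lemma unit_esym_conj t1 t2 t3 : `|t1| = 1 -> `|t2| = 1 -> `|t3| = 1 ->
  t1 * t2 * t3 = 1 -> t1 * t2 + t1 * t3 + t2 * t3 = (t1 + t2 + t3)^*.
Proof.
move=> u1 u2 u3 e3; rewrite !rmorphD /= !conjC_unit//.
have t10 : t1 != 0 by rewrite -normr_gt0 u1.
have t20 : t2 != 0 by rewrite -normr_gt0 u2.
have t30 : t3 != 0 by rewrite -normr_gt0 u3.
have -> : t1^-1 + t2^-1 + t3^-1 = (t1 * t2 + t1 * t3 + t2 * t3) / (t1 * t2 * t3).
  by field; rewrite t10 t20 t30.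
by rewrite e3 divr1.
Qed.

(** Conjugation inverts unit roots, which multiplies the Vandermonde product by -1 / e3^2 = -1: it
    is purely imaginary. *)
Lemma unit_vdm3_sqr_le0 t1 t2 t3 : `|t1| = 1 -> `|t2| = 1 -> `|t3| = 1 ->
  t1 * t2 * t3 = 1 -> vdm3 t1 t2 t3 ^+ 2 <= 0.
Proof.
move=> u1 u2 u3 e3.
have t10 : t1 != 0 by rewrite -normr_gt0 u1.
have t20 : t2 != 0 by rewrite -normr_gt0 u2.
have t30 : t3 != 0 by rewrite -normr_gt0 u3.
have hD : (vdm3 t1 t2 t3)^* = - vdm3 t1 t2 t3.
  rewrite /vdm3 !rmorphM !rmorphB /= !conjC_unit//.
  have -> : (t1^-1 - t2^-1) * (t1^-1 - t3^-1) * (t2^-1 - t3^-1)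
      = - vdm3 t1 t2 t3 / (t1 * t2 * t3) ^+ 2.
    by rewrite /vdm3; field; rewrite t10 t20 t30.
  by rewrite e3 expr1n divr1.
have -> : vdm3 t1 t2 t3 ^+ 2 = - `|vdm3 t1 t2 t3| ^+ 2.
  by rewrite normCK hD mulrN opprK expr2.
by rewrite oppr_le0 exprn_ge0.
Qed.

(* If two of the roots are exchanged by t |-> 1 / t^* without being fixed, the
   Vandermonde product is real and nonzero. *)
Lemma vdm3_sqr_gt0 t1 t2 t3 : t1 * t2 * t3 = 1 -> t1^* * t2 = 1 -> `|t1| != 1 ->
  0 < vdm3 t1 t2 t3 ^+ 2.
Proof.
move=> e3 h n1; set b := t1^* in h.
have b0 : b != 0 by apply/eqP => b0; move/eqP: h; rewrite b0 mul0r eq_sym oner_eq0.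
have t10 : t1 != 0 by move: b0; rewrite /b conjC_eq0.
have e2 : t2 = b^-1 by apply: (mulfI b0); rewrite h mulfV.
have e3' : t3 = b / t1.
  apply: (mulfI (_ : t1 * t2 != 0)); first by rewrite e2 mulf_neq0// invr_eq0.
  by rewrite e3 e2; field; rewrite t10 b0.
have N : t1 * b = `|t1| ^+ 2 by rewrite normCK.
(* Substituting t2 = 1 / b and t3 = b / t1 makes the product visibly real. It vanishes only if |t1|
   = 1 or t1^2 = b, and the latter again gives |t1| = 1. *)
have hD : vdm3 t1 t2 t3
    = - (`|t1| ^+ 2 - 1) * `|t1 ^+ 2 - b| ^+ 2 / (`|t1| ^+ 2) ^+ 2.
  rewrite -N normCK rmorphB rmorphXn /= -/b conjCK /vdm3 e2 e3'.
  by field; rewrite t10 b0.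
have rD : vdm3 t1 t2 t3 \is Num.real.
  by rewrite hD ?(realM, realV, rpredM, rpredV, rpredX, rpredN, rpredB, rpredD)//;
     rewrite ?normr_real ?rpred1.
have n1' : `|t1| ^+ 2 != 1 by rewrite -[X in _ != X](expr1n _ 2) eqrXn2.
have nb : t1 ^+ 2 - b != 0.
  apply/eqP => /subr0_eq hb; move/eqP: n1; apply.
  have := congr1 Num.norm hb; rewrite normrX norm_conjC expr2 => hn.
  by apply: (mulfI (_ : `|t1| != 0)); rewrite ?normr_eq0// mulr1.
have D0 : vdm3 t1 t2 t3 != 0.
  rewrite hD mulf_neq0 ?invr_eq0 ?expf_neq0 ?normr_eq0//.
  by rewrite mulf_neq0 ?expf_neq0 ?normr_eq0// oppr_eq0 subr_eq0.
by rewrite real_exprn_even_gt0.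
Qed.

(** Conjugation reverses the coefficients of the cubic, so 1 / t1^* is also a root. Either it is t1
    itself, or [vdm3_sqr_gt0] contradicts the sign of the discriminant. *)
Lemma root_unit t1 t2 t3 : t1 * t2 * t3 = 1 ->
  t1 * t2 + t1 * t3 + t2 * t3 = (t1 + t2 + t3)^* ->
  vdm3 t1 t2 t3 ^+ 2 <= 0 -> `|t1| = 1.
Proof.
move=> e3 e12 D0; set b := t1^*.
apply/eqP; apply: contraTT D0 => n1.
have e21 : (t1 * t2 + t1 * t3 + t2 * t3)^* = t1 + t2 + t3 by rewrite e12 conjCK.
(* This product is the reversed cubic at b, hence up to sign the conjugate of the cubic at t1. *)
have hb : (1 - b * t1) * (1 - b * t2) * (1 - b * t3) = 0.
  have hc : t1 ^+ 3 - (t1 + t2 + t3) * t1 ^+ 2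
      + (t1 * t2 + t1 * t3 + t2 * t3) * t1 - t1 * t2 * t3 = 0 by ring.
  move: (congr1 Num.conj hc).
  rewrite e3 rmorph0 rmorphB rmorphD rmorphB !(rmorphXn, rmorphM) /= rmorph1 e21 -e12 -/b => hb.
  have -> : (1 - b * t1) * (1 - b * t2) * (1 - b * t3)
    = 1 - b * (t1 + t2 + t3) + b ^+ 2 * (t1 * t2 + t1 * t3 + t2 * t3)
      - b ^+ 3 * (t1 * t2 * t3) by ring.
  by rewrite e3 -[RHS]oppr0 -hb; ring.
suff: 0 < vdm3 t1 t2 t3 ^+ 2 by move=> /lt_geF ->.
move/eqP: hb; rewrite !mulf_eq0 -orbA => /or3P[] /eqP/subr0_eq/esym h.
- case/eqP: n1; apply/eqP; rewrite -(@eqrXn2 _ 2)// normCK expr1n mulrC.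
  exact/eqP.
- exact: vdm3_sqr_gt0.
- have -> : vdm3 t1 t2 t3 ^+ 2 = vdm3 t1 t3 t2 ^+ 2 by rewrite /vdm3; ring.
  by apply: vdm3_sqr_gt0 => //; rewrite mulrAC.
Qed.

Lemma roots_unit t1 t2 t3 : t1 * t2 * t3 = 1 ->
  t1 * t2 + t1 * t3 + t2 * t3 = (t1 + t2 + t3)^* ->
  vdm3 t1 t2 t3 ^+ 2 <= 0 -> [/\ `|t1| = 1, `|t2| = 1 & `|t3| = 1].
Proof.
move=> e3 e12 D0; split; first exact: (root_unit _ t2 t3).
- apply: (root_unit _ t1 t3).
  + by rewrite -e3; ring.
  + by rewrite [t2 + t1]addrC -e12; ring.
  + by have -> : vdm3 t2 t1 t3 ^+ 2 = vdm3 t1 t2 t3 ^+ 2 by rewrite /vdm3; ring.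
- apply: (root_unit _ t1 t2).
  + by rewrite -e3; ring.
  + by rewrite -[t3 + t1 + t2]addrA [t3 + _]addrC -e12; ring.
  + by have -> : vdm3 t3 t1 t2 ^+ 2 = vdm3 t1 t2 t3 ^+ 2 by rewrite /vdm3; ring.
Qed.

(* The root z of z^3 = q + i sqrt (p^3 - q^2). *)
Lemma norm_re_cube (p q : C) : p \is Num.real -> q \is Num.real ->
  q ^+ 2 <= p ^+ 3 -> exists z, z * z^* = p /\ (z ^+ 3 + z^* ^+ 3) / 2%:R = q.
Proof.
move=> pr qr hpq.
set s := sqrtC (p ^+ 3 - q ^+ 2).
have s0 : 0 <= s by rewrite sqrtC_ge0 subr_ge0.
have sr : s^* = s by apply/CrealP; exact: ger0_real.
have qr' : q^* = q by exact/CrealP.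
set z := 3.-root (q + 'i * s).
have hz : z ^+ 3 = q + 'i * s by rewrite rootCK.
have hz' : z^* ^+ 3 = q - 'i * s.
  by rewrite -rmorphXn hz rmorphD rmorphM /= conjCi qr' sr mulNr.
(* Since p^3 >= q^2 >= 0, the case p <= 0 forces p = 0. *)
have p0 : 0 <= p.
  case/orP: (pr) => // p0.
  have : p ^+ 3 <= 0 by rewrite exprS mulr_le0_ge0// real_exprn_even_ge0.
  move=> p30.
  have : q ^+ 2 <= 0 by exact: le_trans p30.
  have q2 : 0 <= q ^+ 2 by rewrite real_exprn_even_ge0.
  move=> q2'; have q20 : q ^+ 2 = 0 by apply/eqP; rewrite eq_le q2 q2'.
  move: hpq; rewrite q20 => p3.
  have : p ^+ 3 == 0 by rewrite eq_le p30 p3.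
  by rewrite expf_eq0 /= => /eqP ->.
exists z; split; last by rewrite hz hz'; field.
(* Both sides are nonnegative, so cubes may be compared: |z|^6 = q^2 + s^2 = p^3. *)
rewrite -normCK; apply/eqP; rewrite -(@eqrXn2 _ 3) ?exprn_ge0//.
rewrite normCK exprMn hz hz'; apply/eqP.
have -> : (q + 'i * s) * (q - 'i * s) = q ^+ 2 - 'i ^+ 2 * s ^+ 2 by ring.
by rewrite sqrCi /s sqrtCK; ring.
Qed.

End CubicRoots.

(** * Bounded orbits *)

Section Orbits.
Variable R : realType.
Local Notation C := R[i].
Import ComplexField.Normc.

(** * Lifting to the roots, where the map is t -> t^d *)

Definition D3_quot (x y : C) : C * C := (x * y, (x ^+ 3 + y ^+ 3) / 2%:R).

Definition quot_param (t1 t2 t3 : C) : C * C :=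
  D3_quot (esym1 t1 t2 t3) (esym2 t1 t2 t3).

(** The cubes x^3 and y^3 must be the roots q + r and q - r of X^2 - 2 q X + p^3. A cube root x of
    the first and y = p / x fit; p = 0 is treated apart, as q + r may then vanish. *)
Lemma quot_param_surj (w : C * C) : exists t1 t2 t3,
  t1 * t2 * t3 = 1 /\ w = quot_param t1 t2 t3.
Proof.
case: w => p q.
set r := sqrtC (q ^+ 2 - p ^+ 3).
have hr : r ^+ 2 = q ^+ 2 - p ^+ 3 by exact: sqrtCK.
suff [x [y ->]] : exists x y, (p, q) = D3_quot x y.
  have [t1 [t2 [t3 [e3 e1 e2]]]] := cubic_roots _ x y.
  by exists t1, t2, t3; rewrite /quot_param /esym1 /esym2 e1 e2.
have [p0|p0] := eqVneq p 0.
  exists (3.-root (2%:R * q)), 0.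
  by rewrite /D3_quot p0 mulr0 rootCK// expr0n addr0; congr (_, _); field.
set x := 3.-root (q + r).
have hx : x ^+ 3 = q + r by rewrite rootCK.
have hqr : (q + r) * (q - r) = p ^+ 3.
  have -> : (q + r) * (q - r) = q ^+ 2 - r ^+ 2 by ring.
  by rewrite hr; ring.
have qr0 : q + r != 0.
  by apply/eqP => qr0; move/eqP: hqr; rewrite qr0 mul0r eq_sym expf_eq0 (negPf p0).
have x0 : x != 0 by apply/eqP => x0; move/eqP: qr0; apply; rewrite -hx x0 expr0n.
exists x, (p / x); congr (_, _); first by field.
by rewrite expr_div_n hx -hqr; field.
Qed.

Lemma Ftilde_M2inv (x y : C) : Ftilde (M2inv (x, y)) = D3_quot x y.
Proof.
have i2 : 'i ^+ 2 = -1 :> C by exact: sqrCi.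
have i0 : 'i != 0 :> C by exact: neq0Ci.
rewrite /Ftilde /M2inv /D3_quot /= !expr_div_n !exprMn i2.
by congr (_, _); field.
Qed.

Lemma Ftilde_M2 (w : C * C) : Ftilde w = D3_quot (M2 w).1 (M2 w).2.
Proof. by rewrite -Ftilde_M2inv -surjective_pairing M2K. Qed.

Lemma is_chebyshev_A2_cheb d :
  is_chebyshev_A2 d (fun z : C * C => (cheb C d z.1 z.2, cheb C d z.2 z.1)).
Proof.
move=> t1 t2 t3 h1 h2 h3 e3.
by rewrite /esym1 /esym2 /= cheb_power_sum// cheb_inv_power_sum.
Qed.

Lemma chebyshev_A2P d : is_chebyshev_A2 d (@chebyshev_A2 R d).
Proof.
by have := @xgetPex (C * C -> C * C)%type idfun _ (ex_intro [set P | is_chebyshev_A2 d P] _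
  (is_chebyshev_A2_cheb d)).
Qed.

Lemma prod3_neq0 (t1 t2 t3 : C) : t1 * t2 * t3 = 1 ->
  [/\ t1 != 0, t2 != 0 & t3 != 0].
Proof.
move=> e3; have : t1 * t2 * t3 != 0 by rewrite e3 oner_neq0.
by rewrite !mulf_eq0 !negb_or => /andP[/andP[]].
Qed.

Lemma chebyshev_A2E d (x y : C) :
  chebyshev_A2 d (x, y) = (cheb C d x y, cheb C d y x).
Proof.
have [t1 [t2 [t3 [e3 <- <-]]]] := cubic_roots _ x y.
have [h1 h2 h3] := prod3_neq0 _ _ _ e3.
by rewrite [LHS]chebyshev_A2P// -(is_chebyshev_A2_cheb d).
Qed.

(** The D_3-invariance of [cheb] supplies the polynomials in the quotient coordinates that witness
    existence for the choice operator. *)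
Lemma g_A2P d : is_g_A2 d (@g_A2 R d).
Proof.
suff h : exists g : C * C -> C * C, is_g_A2 d g.
  exact: (@xgetPex (C * C -> C * C)%type idfun [set g | is_g_A2 d g] h).
have two0 : 2%:R != 0 :> C by rewrite pnatr_eq0.
have [[G1 [[p1 hp1] h1]] [G2 [[p2 hp2] h2]]] := cheb_D3_invariant C two0 d.
exists (fun w => (G1 w.1 w.2, G2 w.1 w.2)); split.
  by exists p1, p2 => w; rewrite hp1 hp2.
apply/funext => w.
rewrite /f_A2 /comp (Ftilde_M2 w); case: (M2 w) => x y.
by rewrite chebyshev_A2E Ftilde_M2inv /D3_quot /= -h1 -h2.
Qed.

Lemma g_A2_quot_param d (t1 t2 t3 : C) : t1 * t2 * t3 = 1 ->
  g_A2 d (quot_param t1 t2 t3) = quot_param (t1 ^+ d) (t2 ^+ d) (t3 ^+ d).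
Proof.
move=> e3; have [h1 h2 h3] := prod3_neq0 _ _ _ e3.
have [_ /(congr1 (fun f => f (M2inv (esym1 t1 t2 t3, esym2 t1 t2 t3)))) /=] := g_A2P d.
by rewrite /f_A2 /= M2invK Ftilde_M2inv chebyshev_A2P// Ftilde_M2inv.
Qed.

Lemma iter_g_A2 d k (t1 t2 t3 : C) : t1 * t2 * t3 = 1 ->
  iter k (g_A2 d) (quot_param t1 t2 t3)
  = quot_param (t1 ^+ (d ^ k)) (t2 ^+ (d ^ k)) (t3 ^+ (d ^ k)).
Proof.
move=> e3; elim: k => [|k IH]; first by rewrite !expr1.
rewrite iterS IH g_A2_quot_param; last by rewrite -!exprMn e3 expr1n.
by rewrite -!exprM expnSr.
Qed.

(** * Real-valued moduli and bounds on the roots *)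

Lemma normr_normc (z : C) : `|z| = (normc z)%:C%C.
Proof. by rewrite normc_def; case: z. Qed.

Lemma normc_ge0 (z : C) : 0 <= normc z.
Proof. by rewrite -ler0c -normr_normc. Qed.

Lemma normcX (z : C) n : normc (z ^+ n) = normc z ^+ n.
Proof. by apply: complexI; rewrite -normr_normc normrX normr_normc rmorphXn. Qed.

Lemma normc_nat n : normc (n%:R : C) = n%:R.
Proof. by apply: complexI; rewrite -normr_normc normr_nat rmorph_nat. Qed.

Lemma bounded_set_pairP (A : set (C * C)) :
  bounded_set (A : set (C^o * C^o)%type) <->
  exists M : R, forall w, A w -> normc w.1 <= M /\ normc w.2 <= M.
Proof.
have le_norm (w : C * C) (M : R) :
    (`|(w : (C^o * C^o)%type)| <= M%:C%C) = (normc w.1 <= M) && (normc w.2 <= M).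
  rewrite prod_normE comparable_ge_max; last by rewrite real_comparable ?normr_real.
  by rewrite /= !normr_normc !lecR.
split.
  case=> M [Mr hM]; move/complex_realP: Mr => [m hm].
  (* The given bound holds for numbers strictly above m, hence m + 1. *)
  exists (m + 1) => w Aw; apply/andP; rewrite -le_norm.
  by apply: (hM _ _ w Aw); rewrite hm ltcR ltrDl.
case=> M hM; exists M%:C%C; split; first exact/complex_realP/ex_intro.
move=> x ltMx w Aw; apply: le_trans (ltW ltMx); rewrite le_norm.
by apply/andP; exact: hM.
Qed.

Lemma normcD (x y : C) : normc (x + y) <= normc x + normc y.
Proof. by rewrite -lecR rmorphD /= -!normr_normc ler_normD. Qed.

Lemma normcB (x y : C) : normc (x - y) <= normc x + normc y.
Proof. by rewrite -lecR rmorphD /= -!normr_normc ler_normB. Qed.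

(** Beyond 3 M^3, |X|^2 would exceed 2 M |X| + M^3. The quadratic is the one with roots x^3 and
    y^3. *)
Lemma quadratic_bound (X p q : C) (M : R) : 1 <= M ->
  normc p <= M -> normc q <= M -> X ^+ 2 = 2%:R * q * X - p ^+ 3 ->
  normc X <= 3%:R * M ^+ 3.
Proof.
move=> M1 hp hq hX.
have X0 := normc_ge0 X; have p0 := normc_ge0 p; have q0 := normc_ge0 q.
have h : normc X ^+ 2 <= 2%:R * normc q * normc X + normc p ^+ 3.
  rewrite -normcX hX (le_trans (normcB _ _))//.
  by rewrite normcX !normcM normc_nat.
have hp3 : normc p ^+ 3 <= M ^+ 3 by rewrite lerXn2r// nnegrE (le_trans _ hp).
have hM3 : M <= M ^+ 3 by rewrite ler_eXnr.
have hqX : normc q * normc X <= M ^+ 3 * normc X by apply: ler_wpM2r => //; lra.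
rewrite leNgt; apply/negP => hlt; nra.
Qed.

Lemma cube_le (r M : R) : 0 <= r -> 1 <= M -> r ^+ 3 <= M -> r <= M.
Proof.
move=> r0 M1 h; have [r1|r1] := lerP r 1; first exact: le_trans M1.
by apply: le_trans h; rewrite ler_eXnr// ltW.
Qed.

(** Since t1 is a root of the cubic, |t1|^3 <= B |t1|^2 + B |t1| + 1, which fails beyond 3 B. *)
Lemma cubic_bound (t1 t2 t3 : C) (B : R) : 1 <= B -> t1 * t2 * t3 = 1 ->
  normc (esym1 t1 t2 t3) <= B -> normc (esym2 t1 t2 t3) <= B ->
  normc t1 <= 3%:R * B.
Proof.
move=> B1 e3 h1 h2; have t0 := normc_ge0 t1.
have h : normc t1 ^+ 3 <= B * normc t1 ^+ 2 + B * normc t1 + 1.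
  have -> : normc t1 ^+ 3
    = normc (esym1 t1 t2 t3 * t1 ^+ 2 - esym2 t1 t2 t3 * t1 + 1).
    by rewrite -normcX; congr normc; rewrite -e3 /esym1 /esym2; ring.
  rewrite (le_trans (normcD _ _))// normc1 lerD2r.
  rewrite (le_trans (normcB _ _))// (normcM (esym1 _ _ _)) (normcM (esym2 _ _ _)) normcX.
  by rewrite lerD// ler_wpM2r// exprn_ge0.
rewrite leNgt; apply/negP => hlt.
have t1' : 1 <= normc t1 by lra.
have : normc t1 <= normc t1 ^+ 2 by rewrite ler_eXnr.
move: h; rewrite exprS.
have : 3%:R * B * normc t1 ^+ 2 < normc t1 * normc t1 ^+ 2.
  by rewrite ltr_pM2r// exprn_gt0//; lra.
have : 1 <= normc t1 ^+ 2 by rewrite expr_ge1.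
by nra.
Qed.

(** The bound passes from (p, q) to x^3 and y^3, then to x and y, then to the root. *)
Lemma quot_param_bound (t1 t2 t3 : C) (M : R) : 1 <= M -> t1 * t2 * t3 = 1 ->
  normc (quot_param t1 t2 t3).1 <= M -> normc (quot_param t1 t2 t3).2 <= M ->
  normc t1 <= 3%:R * (3%:R * M ^+ 3).
Proof.
move=> M1 e3; rewrite /quot_param /D3_quot /=.
set x := esym1 _ _ _; set y := esym2 _ _ _ => hp hq.
have B1 : 1 <= 3%:R * M ^+ 3 by have := exprn_ege1 3 M1; lra.
apply: (cubic_bound t1 t2 t3) => //.
- apply: cube_le => //; first exact: normc_ge0.
  by rewrite -/x -normcX; apply: (quadratic_bound _ _ _ _ M1 hp hq); field.
- apply: cube_le => //; first exact: normc_ge0.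
  by rewrite -/y -normcX; apply: (quadratic_bound _ _ _ _ M1 hp hq); field.
Qed.

Lemma bernoulli_ineq (h : R) n : 0 <= h -> 1 + n%:R * h <= (1 + h) ^+ n.
Proof.
move=> h0; elim: n => [|n IH]; first by rewrite mul0r addr0.
rewrite exprS -natr1; have : 0 <= n%:R * h ^+ 2 by rewrite mulr_ge0// sqr_ge0.
by nra.
Qed.

(** If r > 1, Bernoulli's inequality makes r^(n+1) grow at least linearly, and d^(n+1) >= n + 1. *)
Lemma bounded_powers_le1 (r B : R) d : (2 <= d)%N -> 0 <= r ->
  (forall k, (0 < k)%N -> r ^+ (d ^ k) <= B) -> r <= 1.
Proof.
move=> d2 r0 hB; rewrite leNgt; apply/negP => r1.
pose h := r - 1; have h0 : 0 < h by rewrite subr_gt0.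
have B0 : 0 <= B by apply: le_trans (hB 1%N isT); rewrite exprn_ge0.
(* Here n exceeds B / h; [hB] is used at n + 1, which is positive. *)
have := archi_boundP (divr_ge0 B0 (ltW h0)); set n := Num.bound _ => hn.
have hn1 : r ^+ n.+1 <= B.
  apply: le_trans (hB n.+1 isT); rewrite ler_eXn2l//.
  by rewrite ltnW// ltn_expl.
have := bernoulli_ineq h n.+1 (ltW h0); rewrite -natr1.
have -> : 1 + h = r by rewrite /h; ring.
move: hn; rewrite ltr_pdivrMr// => hn; nra.
Qed.

Lemma normc_prod3_eq1 (a b c : R) : 0 <= a <= 1 -> 0 <= b <= 1 -> 0 <= c <= 1 ->
  a * b * c = 1 -> a = 1.
Proof.
move=> /andP[a0 a1] /andP[b0 b1] /andP[c0 c1] e; apply/eqP; rewrite eq_le a1 -e.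
by rewrite -mulrA ler_piMr// mulr_ile1.
Qed.

Lemma K_of_g_A2P d (w : C * C) : (2 <= d)%N ->
  K_of (g_A2 d) w <-> exists t1 t2 t3 : C,
    [/\ `|t1| = 1, `|t2| = 1, `|t3| = 1, t1 * t2 * t3 = 1
      & w = quot_param t1 t2 t3].
Proof.
move=> d2; apply: (iff_trans (bounded_set_pairP _)); split.
- have [t1 [t2 [t3 [e3 ->]]]] := quot_param_surj w => -[M0 hM0].
  pose M := Num.max M0 1.
  have M1 : 1 <= M by rewrite le_max lexx orbT.
  have hM k : (0 < k)%N ->
      normc (quot_param (t1 ^+ (d ^ k)) (t2 ^+ (d ^ k)) (t3 ^+ (d ^ k))).1 <= M /\
      normc (quot_param (t1 ^+ (d ^ k)) (t2 ^+ (d ^ k)) (t3 ^+ (d ^ k))).2 <= M.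
    move=> k0; rewrite -iter_g_A2//.
    have [//|? ?] := hM0 (iter k (g_A2 d) (quot_param t1 t2 t3)).
      by exists k.
    by rewrite !le_max; split; apply/orP; left.
  have e3k k : t1 ^+ (d ^ k) * t2 ^+ (d ^ k) * t3 ^+ (d ^ k) = 1.
    by rewrite -!exprMn e3 expr1n.
  (* [quot_param_bound] controls the first root only; a triple s with the same images lets each root
     take that place. *)
  have le1 (s1 s2 s3 : C) : s1 * s2 * s3 = 1 ->
     (forall k, quot_param (t1 ^+ (d ^ k)) (t2 ^+ (d ^ k)) (t3 ^+ (d ^ k)) =
                quot_param (s1 ^+ (d ^ k)) (s2 ^+ (d ^ k)) (s3 ^+ (d ^ k))) ->
     0 <= normc s1 <= 1.
    move=> es hs; rewrite normc_ge0/=.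
    apply: (@bounded_powers_le1 _ (3%:R * (3%:R * M ^+ 3)) d) => //.
      exact: normc_ge0.
    move=> k k0; rewrite -normcX.
    apply: (quot_param_bound _ (s2 ^+ (d ^ k)) (s3 ^+ (d ^ k))) => //.
    + by rewrite -!exprMn es expr1n.
    + by rewrite -hs; case: (hM k k0).
    + by rewrite -hs; case: (hM k k0).
  have n1 := le1 t1 t2 t3 e3 (fun k => erefl).
  have n2 : 0 <= normc t2 <= 1.
    apply: (le1 t2 t1 t3); first by rewrite [t2 * t1]mulrC.
    by move=> k; rewrite /quot_param /esym1 /esym2; congr D3_quot; ring.
  have n3 : 0 <= normc t3 <= 1.
    apply: (le1 t3 t1 t2); first by rewrite -mulrA mulrC.
    by move=> k; rewrite /quot_param /esym1 /esym2; congr D3_quot; ring.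
  have en : normc t1 * normc t2 * normc t3 = 1.
    by rewrite -!normcM e3 normc1.
  exists t1, t2, t3; split=> //; rewrite normr_normc.
  + by rewrite (normc_prod3_eq1 _ _ _ n1 n2 n3 en).
  + by rewrite (normc_prod3_eq1 _ _ _ n2 n1 n3)// [_ t2 * _]mulrC.
  + by rewrite (normc_prod3_eq1 _ _ _ n3 n1 n2)// -mulrA mulrC.
- move=> [t1 [t2 [t3 [u1 u2 u3 e3 ->]]]].
  have unit1 (t : C) : `|t| = 1 -> normc t = 1.
    by move=> u; apply: complexI; rewrite -normr_normc u.
  (* With |e1|, |e2| <= 3 the coordinates are at most 9 and (27 + 27) / 2. *)
  exists 27%:R => _ [k k0 <-]; rewrite iter_g_A2//.
  set s1 := t1 ^+ _; set s2 := t2 ^+ _; set s3 := t3 ^+ _.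
  have v1 : normc s1 = 1 by rewrite normcX unit1// expr1n.
  have v2 : normc s2 = 1 by rewrite normcX unit1// expr1n.
  have v3 : normc s3 = 1 by rewrite normcX unit1// expr1n.
  have hx : normc (esym1 s1 s2 s3) <= 3%:R.
    have := normcD (s1 + s2) s3; have := normcD s1 s2; rewrite /esym1; lra.
  have hy : normc (esym2 s1 s2 s3) <= 3%:R.
    have := normcD (s1 * s2 + s1 * s3) (s2 * s3).
    have := normcD (s1 * s2) (s1 * s3).
    by rewrite /esym2 !normcM v1 v2 v3; lra.
  rewrite /quot_param /D3_quot /=.
  have x0 := normc_ge0 (esym1 s1 s2 s3); have y0 := normc_ge0 (esym2 s1 s2 s3).
  split; first by rewrite normcM; nra.
  rewrite normcM normcV normc_nat ler_pdivrMr//.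
  apply: le_trans (normcD _ _) _; rewrite !normcX.
  have : normc (esym1 s1 s2 s3) ^+ 3 <= 3%:R ^+ 3 by rewrite lerXn2r// nnegrE.
  have : normc (esym2 s1 s2 s3) ^+ 3 <= 3%:R ^+ 3 by rewrite lerXn2r// nnegrE.
  by rewrite -natrX; lra.
Qed.

(** * The bounded set in real coordinates *)

Lemma K_of_g_A2_real d : (2 <= d)%N -> K_of (@g_A2 R d) `<=` range (@real_embed R).
Proof.
move=> d2 w /K_of_g_A2P-/(_ d2)[t1 [t2 [t3 [u1 u2 u3 e3 ->]]]].
have e12 := unit_esym_conj _ _ _ _ u1 u2 u3 e3.
rewrite /quot_param /D3_quot /esym2 e12 -/(esym1 t1 t2 t3).
set x := esym1 _ _ _.
have pr : x * x^* \is Num.real by rewrite -normCK rpredX// normr_real.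
have qr : (x ^+ 3 + x^* ^+ 3) / 2%:R \is Num.real.
  by apply/CrealP; rewrite !rmorphM rmorphD !rmorphXn /= conjCK fmorphV rmorph_nat addrC.
move/complex_realP: pr => [p ->]; move/complex_realP: qr => [q ->].
by exists (p, q).
Qed.

Definition real_slice : set (R * R) :=
  [set v | v.2 ^+ 2 <= v.1 ^+ 3 /\ v.1 ^+ 2 + 18%:R * v.1 - 27%:R <= 8%:R * v.2].

Lemma real_complex_disc_le0 (p q : R) :
  (p%:C%C ^+ 2 + 18%:R * p%:C%C - 8%:R * q%:C%C - 27%:R <= 0)
  = (p ^+ 2 + 18%:R * p - 27%:R <= 8%:R * q).
Proof.
have -> : p%:C%C ^+ 2 + 18%:R * p%:C%C - 8%:R * q%:C%C - 27%:R
    = (p ^+ 2 + 18%:R * p - 8%:R * q - 27%:R)%:C%C :> C.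
  by rewrite !rmorphB rmorphD !(rmorphXn, rmorphM) /= !rmorph_nat.
rewrite lecR; lra.
Qed.

Lemma K_of_g_A2_slice d : (2 <= d)%N ->
  @real_embed R @^-1` K_of (@g_A2 R d) = real_slice.
Proof.
move=> d2; apply/seteqP; split => -[p q] /=.
- move/K_of_g_A2P => /(_ d2)[t1 [t2 [t3 [u1 u2 u3 e3]]]].
  have := unit_vdm3_sqr_le0 _ _ _ _ u1 u2 u3 e3.
  rewrite vdm3_sqr// (unit_esym_conj _ _ _ _ u1 u2 u3 e3).
  rewrite /quot_param /D3_quot /esym2 (unit_esym_conj _ _ _ _ u1 u2 u3 e3) -/(esym1 t1 t2 t3).
  set x := esym1 _ _ _ => + -[hp hq].
  rewrite -hp -hq real_complex_disc_le0; split=> //=.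
  have ep : p = normc x ^+ 2 by apply: complexI; rewrite rmorphXn /= -normr_normc normCK.
  have eq : q ^+ 2 = normc q%:C%C ^+ 2.
    by rewrite /= expr0n addr0 sqr_sqrtr// sqr_ge0.
  have nxJ : normc x^* = normc x by apply: complexI; rewrite -!normr_normc norm_conjC.
  (* As p^3 = (|x|^3)^2, what remains is |q| <= |x|^3, where q is the mean of x^3 and its
     conjugate. *)
  rewrite eq ep -exprM -[(2 * 3)%N]/(3 * 2)%N exprM lerXn2r ?nnegrE ?exprn_ge0 ?normc_ge0//.
  rewrite hq normcM normcV normc_nat ler_pdivrMr//.
  by apply: le_trans (normcD _ _) _; rewrite !normcX nxJ; lra.
- move=> [/= h1 h2]; apply/K_of_g_A2P => //.
  have realC (a : R) : a%:C%C \is Num.real by exact/complex_realP/ex_intro.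
  have [|x [hp hq]] := norm_re_cube _ _ _ (realC p) (realC q).
    by rewrite -!rmorphXn lecR.
  have [t1 [t2 [t3 [e3 e1 e2]]]] := cubic_roots _ x x^*.
  have [|//|u1 u2 u3] := roots_unit _ _ _ _ e3; first by rewrite e1 e2.
    by rewrite vdm3_sqr// e1 e2 hp hq real_complex_disc_le0.
  exists t1, t2, t3; split=> //.
  by rewrite /quot_param /D3_quot /esym1 /esym2 e1 e2 hp hq.
Qed.

End Orbits.

(** * The region and its boundary curve *)

Section SliceTopology.
Variable R : realType.

(** * The two arcs and their common points *)

Lemma gamma1P (p q : R) : @gamma1 R (p, q) <->
  exists2 u, -1 <= u <= 3%:R & p = u ^+ 2 /\ q = u ^+ 3.
Proof.
split.
  move=> [t _ [<- <-]]; exists (1 + 2%:R * cos t) => //.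
  by have := cos_geN1 t; have := cos_le1 t; lra.
move=> [u /andP[u1 u2] [-> ->]].
have hu : -1 <= (u - 1) / 2%:R <= 1 by rewrite ler_pdivlMr// ler_pdivrMr//; lra.
exists (acos ((u - 1) / 2%:R)); last first.
  by rewrite acosK ?in_itv//=; congr (_ ^+ _, _ ^+ _); field.
rewrite /= acos_ge0//= (le_lt_trans (acos_lepi hu))//.
by have := pi_gt0 R; lra.
Qed.

Lemma gamma2P (p q : R) : @gamma2 R (p, q) <->
  1 <= p <= 9%:R /\ 8%:R * q = p ^+ 2 + 18%:R * p - 27%:R.
Proof.
split.
  move=> [t _ [<- <-]]; split; last by ring.
  by have := cos_geN1 t; have := cos_le1 t; lra.
move=> [/andP[p1 p9] hq].
have hp : -1 <= (p - 5%:R) / 4%:R <= 1 by rewrite ler_pdivlMr// ler_pdivrMr//; lra.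
exists (acos ((p - 5%:R) / 4%:R)).
  by rewrite /= acos_ge0//= (le_trans (acos_lepi hp))//; have := pi_gt0 R; lra.
rewrite acosK ?in_itv//=; congr (_, _); first by field.
have -> : q = (p ^+ 2 + 18%:R * p - 27%:R) / 8%:R by rewrite -hq; field.
by field.
Qed.

(** The second boundary function along the cuspidal curve: its simple zero u = -1 and triple zero u
    = 3 are the common points (1, -1) and (9, 27). *)
Lemma cusp_quartic (u : R) :
  (u ^+ 2) ^+ 2 + 18%:R * u ^+ 2 - 27%:R - 8%:R * u ^+ 3 = (u + 1) * (u - 3%:R) ^+ 3.
Proof. by ring. Qed.

Lemma cusp_quartic_le0 (u : R) :
  ((u ^+ 2) ^+ 2 + 18%:R * u ^+ 2 - 27%:R <= 8%:R * u ^+ 3) = (-1 <= u <= 3%:R).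
Proof.
rewrite -subr_le0 cusp_quartic.
apply/idP/idP => [h|/andP[h1 h2]]; last first.
  by rewrite mulr_ge0_le0 ?exprn_odd_le0 ?subr_le0//; lra.
apply/andP; split; rewrite leNgt; apply/negP => hu; move: h; apply/negP; rewrite -ltNge.
  by rewrite nmulr_rgt0 ?exprn_odd_lt0// ?subr_lt0; lra.
by rewrite pmulr_rgt0 ?exprn_gt0 ?subr_gt0//; lra.
Qed.

(** On this curve 64 (q^2 - p^3) factors as (p - 1) (p - 9)^3. *)
Lemma slice_discriminant (p q : R) : 8%:R * q = p ^+ 2 + 18%:R * p - 27%:R ->
  (q ^+ 2 <= p ^+ 3) = (1 <= p <= 9%:R).
Proof.
move=> hq.
have e : 64%:R * (q ^+ 2 - p ^+ 3) = (p - 1) * (p - 9%:R) ^+ 3.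
  have -> : 64%:R * (q ^+ 2 - p ^+ 3) = (8%:R * q) ^+ 2 - 64%:R * p ^+ 3 by ring.
  by rewrite hq; ring.
have -> : (q ^+ 2 <= p ^+ 3) = ((p - 1) * (p - 9%:R) ^+ 3 <= 0).
  by rewrite -e pmulr_rle0 ?subr_le0// ltr0n.
apply/idP/idP => [h|/andP[h1 h2]]; last first.
  by rewrite mulr_ge0_le0 ?exprn_odd_le0 ?subr_le0 ?subr_ge0.
apply/andP; split; rewrite leNgt; apply/negP => hu; move: h; apply/negP; rewrite -ltNge.
  by rewrite nmulr_rgt0 ?exprn_odd_lt0// ?subr_lt0//; lra.
by rewrite pmulr_rgt0 ?exprn_gt0 ?subr_gt0//; lra.
Qed.

Lemma cuspP (p q : R) : q ^+ 2 = p ^+ 3 -> exists u, p = u ^+ 2 /\ q = u ^+ 3.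
Proof.
move=> h; have [p0|p0] := eqVneq p 0.
  exists 0; rewrite p0 !expr0n; split=> //; apply/eqP.
  by rewrite -sqrf_eq0 h p0 expr0n.
exists (q / p); rewrite !expr_div_n h; split; first by field.
by rewrite -h; field; rewrite -sqrf_eq0 h expf_neq0.
Qed.

(** Each arc is the part of its curve where the other inequality holds; the two factorisations cut
    out -1 <= u <= 3 and 1 <= p <= 9. *)
Lemma gammaE : @gamma R = [set v | real_slice R v /\
  (v.2 ^+ 2 = v.1 ^+ 3 \/ 8%:R * v.2 = v.1 ^+ 2 + 18%:R * v.1 - 27%:R)].
Proof.
apply/seteqP; split => -[p q] /=.
  case=> [/gamma1P[u hu [-> ->]]|/gamma2P[hp hq]].
    split; [split=> /=|left]; first by rewrite -!exprM.
      by rewrite cusp_quartic_le0.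
    by rewrite -!exprM.
  by split; [split=> /=|right] => //; rewrite ?(slice_discriminant _ _ hq)// hq.
move=> [[/= h1 h2]] [h|h].
  left; apply/gamma1P; have [u [pu qu]] := cuspP _ _ h.
  by exists u => //; rewrite -cusp_quartic_le0 -pu -qu.
by right; apply/gamma2P; rewrite -(slice_discriminant _ _ h).
Qed.

(** * Interior and boundary of the region *)

Lemma cvg_exprn (T : Type) (F : set_system T) (FF : Filter F) (f : T -> R) (a : R) n :
  f x @[x --> F] --> a -> f x ^+ n @[x --> F] --> a ^+ n.
Proof. exact: (@continuous_cvg T R R F FF f (fun y : R => y ^+ n) a (@exprn_continuous R n a)). Qed.

Let F1 (v : R * R) := v.1 ^+ 3 - v.2 ^+ 2.
Let F2 (v : R * R) := 8%:R * v.2 - (v.1 ^+ 2 + 18%:R * v.1 - 27%:R).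

Let cF1 : continuous F1.
Proof.
move=> v; apply: cvgB; apply: cvg_exprn; [exact: cvg_fst|exact: cvg_snd].
Qed.

Let cF2 : continuous F2.
Proof.
move=> v; apply: cvgB; first by apply: cvgM; [exact: cvg_cst|exact: cvg_snd].
apply: cvgB; last exact: cvg_cst.
apply: cvgD; first by apply: cvg_exprn; exact: cvg_fst.
by apply: cvgM; [exact: cvg_cst|exact: cvg_fst].
Qed.

Let real_sliceE : real_slice R = F1 @^-1` [set x | 0 <= x] `&` F2 @^-1` [set x | 0 <= x].
Proof.
by apply/seteqP; split => v /=; rewrite /real_slice /F1 /F2 /= !subr_ge0.
Qed.

Lemma closed_real_slice : closed (real_slice R).
Proof.
rewrite real_sliceE; apply: closedI; apply: preimage_closed; try exact: closed_ge.
- by move=> v _; exact: cF1.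
- by move=> v _; exact: cF2.
Qed.

(** Strict inequalities are open conditions. Conversely, at a point with an equality some short
    vertical move leaves the region. *)
Lemma interior_real_slice :
  (real_slice R)^° = [set v | v.2 ^+ 2 < v.1 ^+ 3 /\
     v.1 ^+ 2 + 18%:R * v.1 - 27%:R < 8%:R * v.2].
Proof.
apply/seteqP; split => [[p q] hint|[p q] /= [h1 h2]]; last first.
  have : nbhs ((p, q) : R * R) (F1 @^-1` [set x | 0 < x] `&` F2 @^-1` [set x | 0 < x]).
    by apply: filterI; [apply: cF1|apply: cF2]; apply: open_nbhs_nbhs; split;
       [exact: open_gt|rewrite /= subr_gt0|exact: open_gt|rewrite /= subr_gt0].
  apply: filterS => v [] /=; rewrite /F1 /F2 !subr_gt0 => ? ?.
  by split; exact: ltW.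
have [e e0 he] : exists2 e, 0 < e &
    forall x, `|x| < e -> real_slice R (p, q + x).
  have /nbhs_ballP[e e0 he] := hint.
  exists e => // x hx; apply: he; split => /=; first exact: ballxx.
  by rewrite /ball /= opprD addNKr normrN.
have e2 : `|e / 2%:R| < e.
  by have e0' : 0 < e by []; rewrite gtr0_norm ?divr_gt0// ltr_pdivrMr//; lra.
have e2' : `|- (e / 2%:R)| < e by rewrite normrN.
have [/= a1 a2] := he _ e2; have [/= b1 b2] := he _ e2'.
have e0' : 0 < e by [].
(* Moving q away from 0 increases q^2, hence the split on its sign; moving q down gives the other
   inequality. *)
split=> /=; first by case: (lerP 0 q) => hq; nra.
by lra.
Qed.

Lemma boundary_real_slice : boundary (real_slice R) = @gamma R.
Proof.
rewrite /boundary -(closure_id _).1; last exact: closed_real_slice.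
rewrite interior_real_slice gammaE; apply/seteqP; split => -[p q] /= [hs].
  case: (hs) => /= h1 h2 hn; split => //.
  move: h1 h2; rewrite !le_eqVlt => /orP[/eqP ? _|h1]; first by left.
  by move=> /orP[/eqP ?|h2]; [right|case: hn].
by move=> h; split=> // -[h1 h2]; case: h => h; move: h1 h2; rewrite h ltxx.
Qed.

(* The two pieces are glued by clamping: on [0, 1/2] the parameter u runs over
   [-1, 3] along gamma1, on [1/2, 1] the abscissa runs from 9 down to 1 along
   gamma2. *)
Definition gamma_param (s : R) : R * R :=
  let u := 8%:R * Num.min s 2^-1 - 1 in
  let p := 9%:R - 16%:R * (Num.max s 2^-1 - 2^-1) in
  (u ^+ 2 + p - 9%:R, u ^+ 3 + (p ^+ 2 + 18%:R * p - 27%:R) / 8%:R - 27%:R).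

Lemma continuous_gamma_param : continuous gamma_param.
Proof.
move=> s.
pose u (s : R) := 8%:R * Num.min s 2^-1 - 1.
pose p (s : R) := 9%:R - 16%:R * (Num.max s 2^-1 - 2^-1).
have cu : u x @[x --> s] --> u s.
  apply: cvgB; last exact: cvg_cst.
  apply: cvgM; first exact: cvg_cst.
  by apply: (@continuous_min _ _ (fun s : R => s) (fun=> 2^-1)); [exact: cvg_id|exact: cvg_cst].
have cp : p x @[x --> s] --> p s.
  apply: cvgB; first exact: cvg_cst.
  apply: cvgM; first exact: cvg_cst.
  apply: cvgB; last exact: cvg_cst.
  by apply: (@continuous_max _ _ (fun s : R => s) (fun=> 2^-1)); [exact: cvg_id|exact: cvg_cst].
have c1 : u x ^+ 2 + p x - 9%:R @[x --> s] --> u s ^+ 2 + p s - 9%:R.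
  by apply: cvgB; [apply: cvgD; [apply: cvg_exprn|]|exact: cvg_cst].
have c2 : u x ^+ 3 + (p x ^+ 2 + 18%:R * p x - 27%:R) / 8%:R - 27%:R @[x --> s]
    --> u s ^+ 3 + (p s ^+ 2 + 18%:R * p s - 27%:R) / 8%:R - 27%:R.
  apply: cvgB; last exact: cvg_cst.
  apply: cvgD; first exact: cvg_exprn.
  apply: cvgM; last exact: cvg_cst.
  apply: cvgB; last exact: cvg_cst.
  apply: cvgD; first exact: cvg_exprn.
  by apply: cvgM; first exact: cvg_cst.
exact: (cvg_pair c1 c2).
Qed.

(** The idle piece rests at p = 9, that is at (9, 27), and the constants subtracted in [gamma_param]
    cancel it. *)
Lemma gamma_param_left (s : R) : s <= 2^-1 ->
  gamma_param s = ((8%:R * s - 1) ^+ 2, (8%:R * s - 1) ^+ 3).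
Proof.
by move=> hs; rewrite /gamma_param min_l// max_r//; congr (_, _); field.
Qed.

Lemma gamma_param_right (s : R) : 2^-1 <= s ->
  let p := 17%:R - 16%:R * s in
  gamma_param s = (p, (p ^+ 2 + 18%:R * p - 27%:R) / 8%:R).
Proof.
by move=> hs p; rewrite /gamma_param min_r// max_l//; congr (_, _); rewrite /p; field.
Qed.

(** At a common point the quartic of [cusp_quartic] vanishes. The zero u = -1 would need r = 1,
    which is excluded; u = 3 gives s = r = 1/2. *)
Lemma gamma_param_left_right (s r : R) : 0 <= s <= 2^-1 -> 2^-1 <= r < 1 ->
  gamma_param s = gamma_param r -> s = r.
Proof.
move=> /andP[s0 s1] /andP[r0 r1]; rewrite gamma_param_left// gamma_param_right//.
set p := 17%:R - _ => -[ep eq]; set u := 8%:R * s - 1 in ep eq.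
have : (u + 1) * (u - 3%:R) ^+ 3 = 0 by rewrite -cusp_quartic eq ep; field.
move/eqP; rewrite mulf_eq0 expf_eq0 /= => /orP[]/eqP hu.
  have : p = 1 by rewrite -ep (_ : u = -1) ?sqrrN ?expr1n//; lra.
  by rewrite /p; lra.
have : p = 9%:R by rewrite -ep (_ : u = 3%:R); [ring|lra].
by rewrite /p; move: hu; rewrite /u; lra.
Qed.

Lemma gamma_param_inj : {in `[0, 1[ &, injective gamma_param}.
Proof.
move=> s r; rewrite !in_itv /= => /andP[s0 s1] /andP[r0 r1] e.
have [hs|hs] := lerP s 2^-1; have [hr|hr] := lerP r 2^-1.
(* Equal squares mean equal or opposite u; if opposite, equal cubes make both zero. *)
- move: e; rewrite !gamma_param_left// => -[/eqP]; rewrite eqf_sqr => /orP[/eqP h _|/eqP h]; first by lra.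
  rewrite h => /eqP; rewrite exprNn -signr_odd expr1 mulN1r eqNr expf_eq0 /= => /eqP; lra.
- by apply: gamma_param_left_right => //; rewrite ?s0 ?hs ?(ltW hr) ?r1.
- by apply/esym; apply: gamma_param_left_right => //; rewrite ?r0 ?hr ?(ltW hs) ?s1.
- by move: e; rewrite !gamma_param_right ?ltW// => -[]; lra.
Qed.

Lemma image_gamma_param : gamma_param @` `[0, 1] = @gamma R.
Proof.
apply/seteqP; split.
  move=> _ [s s01 <-]; move: s01; rewrite /= in_itv /= => /andP[s0 s1].
  have [hs|hs] := lerP s 2^-1.
    left; rewrite gamma_param_left//; apply/gamma1P.
    by exists (8%:R * s - 1) => //; apply/andP; split; lra.
  right; rewrite gamma_param_right ?ltW//; apply/gamma2P; split; last by field.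
  by apply/andP; split; lra.
move=> [p q] [/gamma1P[u /andP[u1 u3] [-> ->]]|/gamma2P[/andP[p1 p9] hq]].
  exists ((u + 1) / 8%:R).
    by rewrite /= in_itv /=; apply/andP; split; lra.
  rewrite gamma_param_left; last by lra.
  by congr (_ ^+ _, _ ^+ _); field.
exists ((17%:R - p) / 16%:R).
  by rewrite /= in_itv /=; apply/andP; split; lra.
rewrite gamma_param_right; last by lra.
have -> : 17%:R - 16%:R * ((17%:R - p) / 16%:R) = p by field.
by congr (_, _); rewrite -hq; field.
Qed.

Lemma jordan_curve_gamma : jordan_curve (@gamma R).
Proof.
exists gamma_param; split.
- by apply: continuous_subspaceT; exact: continuous_gamma_param.
(* Both ends are (1, -1), from u = -1 and from p = 1. *)
- rewrite (@gamma_param_left 0) ?invr_ge0// (@gamma_param_right 1) ?invf_le1 ?ler1n//.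
  by congr (_, _); field.
- exact: gamma_param_inj.
- exact: image_gamma_param.
Qed.

End SliceTopology.

Theorem theorem3p12 (R : realType) (d : nat) (hd : (2 <= d)%N) :
  [/\ jordan_curve (@gamma R),
      K_of (@g_A2 R d) `<=` range (@real_embed R) &
      boundary (@real_embed R @^-1` K_of (@g_A2 R d)) = @gamma R].
Proof.
split; first exact: jordan_curve_gamma.
- exact: K_of_g_A2_real.
- by rewrite K_of_g_A2_slice// boundary_real_slice.
Qed.
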